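(* Let $G$ and $H$ be finite simple graphs. Then the following are equivalent: (1) $G$ and $H$ are $\mathfrak{I}$-homotopy equivalent; (2) $G$ and $H$ are $s$-homotopy equivalent; (3) the clique complexes $C(G)$ and $C(H)$ are simple homotopy equivalent.
   Context: Graphs are finite, simple (no loops, no multiple edges). For a graph $G$ and vertex $v$, $N_G(v)$ is the set of vertices adjacent to $v$, $N_G[v]=N_G(v)\cup\{v\}$, and $N_G(v,w)=N_G(v)\cap N_G(w)$. For $S\subseteq V(G)$, $G[S]$ is the induced subgraph; $G-v=G[V(G)\setminus\{v\}]$; for an edge $e$, $G\setminus e$ has the same vertices and edge set $E(G)\setminus\{e\}$. Clique complex: $C(G)$ is the simplicial complex on $V(G)$ whose faces are the vertex sets of complete subgraphs of $G$. Simple homotopy: if $\tau\subset\sigma$ are faces of a simplicial complex $X$ with $\sigma$ a facet, $\dim\tau=\dim\sigma-1$, and no other facet contains $\tau$, removing $\tau$ and $\sigma$ is an elementary collapse; its inverse is an elementary expansion. $X$ and $Y$ are simple homotopy equivalent if there is a finite sequence $X=X_0,\dots,X_n=Y$ with each $X_i$ obtained from $X_{i-1}$ by an elementary collapse or expansion. $s$-homotopy: a vertex $v$ of $G$ is dismantlable if there is $w\neq v$ with $N_G[v]\subseteq N_G[w]$; a graph is dismantlable if it can be reduced to a single vertex by successively removing dismantlable vertices. A vertex $v$ is $s$-dismantlable if $G[N_G(v)]$ is dismantlable. $G$ and $H$ are $s$-homotopy equivalent if there is a sequence $G=G_0,\dots,G_n=H$ where each $G_i$ is obtained from $G_{i-1}$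 by deleting an $s$-dismantlable vertex of $G_{i-1}$, or $G_{i-1}$ is obtained from $G_i$ by deleting an $s$-dismantlable vertex of $G_i$. $\mathfrak{I}$-homotopy: the class $\mathfrak{I}$ is the smallest class of finite graphs containing $K_1$ (one vertex) and closed under: (i) if $G\in\mathfrak{I}$ and $G[N_G(v)]\in\mathfrak{I}$ then $G-v\in\mathfrak{I}$; (ii) if $G-v\in\mathfrak{I}$ and $G[N_G(v)]\in\mathfrak{I}$ then $G\in\mathfrak{I}$; (iii) if $G\in\mathfrak{I}$ and $G[N_G(v,w)]\in\mathfrak{I}$ for an edge $e=\{v,w\}$ then $G\setminus e\in\mathfrak{I}$; (iv) if $G\setminus e\in\mathfrak{I}$ and $G[N_G(v,w)]\in\mathfrak{I}$ for an edge $e=\{v,w\}$ of $G$ then $G\in\mathfrak{I}$. The $\mathfrak{I}$-contractible transformations of a graph $G$ are: ($\mathfrak{I}1$) delete a vertex $v$ with $G[N_G(v)]\in\mathfrak{I}$; ($\mathfrak{I}2$) for $S\subseteq V(G)$ with $G[S]\in\mathfrak{I}$, add a new vertex $v$ with neighborhood exactly $S$; ($\mathfrak{I}3$) delete an edge $\{v,w\}$ with $G[N_G(v,w)]\in\mathfrak{I}$; ($\mathfrak{I}4$) add an edge $\{v,w\}$ between non-adjacent vertices with $G[N_G(v,w)]\in\mathfrak{I}$. $G$ and $H$ are $\mathfrak{I}$-homotopy equivalent if $H$ is obtained from $G$ by a finite sequence of such transformations. *)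

(* Defs.v *)
From Stdlib Require Export Relation_Operators.
From mathcomp Require Export all_boot.
Set Implicit Arguments.
Unset Strict Implicit.
Unset Printing Implicit Defensive.

(* Vertex sets are arbitrary finite types, so graphs (and complexes) are
   considered up to isomorphism: isomorphisms are allowed as steps of every
   homotopy relation below, and the class of I-contractible graphs is closed
   under isomorphism. *)

Record sgraph := SGraph {
  vertex :> finType;
  adj : rel vertex;
  adj_sym : symmetric adj;
  adj_irr : irreflexive adj }.

Definition giso (G H : sgraph) : Prop :=
  exists2 f : G -> H, bijective f & forall x y, adj (f x) (f y) = adj x y.

Section Neighborhoods.
Variable G : sgraph.
Definition nbh (v : G) : {set G} := [set u | adj v u].
Definition cnbh (v : G) : {set G} := v |: nbh v.
Definition nbh2 (v w : G) : {set G} := nbh v :&: nbh w.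
End Neighborhoods.

Section Induced.
Variables (G : sgraph) (S : {set G}).
Definition induced_adj : rel {x : G | x \in S} :=
  fun x y => adj (val x) (val y).
Lemma induced_sym : symmetric induced_adj.
Proof. by move=> x y; apply: adj_sym. Qed.
Lemma induced_irr : irreflexive induced_adj.
Proof. by move=> x; apply: adj_irr. Qed.
Definition induced : sgraph := SGraph induced_sym induced_irr.
End Induced.

Definition del_vertex (G : sgraph) (v : G) : sgraph := induced [set~ v].

Section AddVertex.
Variables (G : sgraph) (S : {set G}).
Definition add_vertex_adj : rel (option G) := fun x y =>
  match x, y with
  | Some a, Some b => adj a b
  | Some a, None => a \in S
  | None, Some b => b \in S
  | None, None => false
  end.
Lemma add_vertex_sym : symmetric add_vertex_adj.
Proof. by move=> [a|] [b|] //=; apply: adj_sym. Qed.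
Lemma add_vertex_irr : irreflexive add_vertex_adj.
Proof. by move=> [a|] //=; apply: adj_irr. Qed.
Definition add_vertex : sgraph := SGraph add_vertex_sym add_vertex_irr.
End AddVertex.

Section Edges.
Variables (G : sgraph) (v w : G).

Definition del_edge_adj : rel G := fun x y =>
  adj x y && ([set x; y] != [set v; w]).
Lemma del_edge_sym : symmetric del_edge_adj.
Proof. by move=> x y; rewrite /del_edge_adj adj_sym setUC. Qed.
Lemma del_edge_irr : irreflexive del_edge_adj.
Proof. by move=> x; rewrite /del_edge_adj adj_irr. Qed.
Definition del_edge : sgraph := SGraph del_edge_sym del_edge_irr.

Definition add_edge_adj : rel G := fun x y =>
  adj x y || (x != y) && ([set x; y] == [set v; w]).
Lemma add_edge_sym : symmetric add_edge_adj.
Proof. by move=> x y; rewrite /add_edge_adj adj_sym eq_sym setUC. Qed.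
Lemma add_edge_irr : irreflexive add_edge_adj.
Proof. by move=> x; rewrite /add_edge_adj adj_irr eqxx. Qed.
Definition add_edge : sgraph := SGraph add_edge_sym add_edge_irr.
End Edges.

Definition dismantlable_vertex (G : sgraph) (v : G) : Prop :=
  exists2 w : G, w != v & cnbh v \subset cnbh w.

Inductive dismantlable : sgraph -> Prop :=
| dismantlable_one (G : sgraph) : #|G| = 1 -> dismantlable G
| dismantlable_del (G : sgraph) (v : G) :
    dismantlable_vertex v -> dismantlable (del_vertex v) -> dismantlable G.

Definition s_dismantlable (G : sgraph) (v : G) : Prop :=
  dismantlable (induced (nbh v)).

Inductive s_deletion : sgraph -> sgraph -> Prop :=
| SDeletion (G : sgraph) (v : G) :
    s_dismantlable v -> s_deletion G (del_vertex v).

Definition s_homotopy_equiv : sgraph -> sgraph -> Prop :=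
  clos_refl_trans sgraph
    (fun G H => [\/ s_deletion G H, s_deletion H G | giso G H]).

Inductive I_contractible : sgraph -> Prop :=
| I_K1 (G : sgraph) : #|G| = 1 -> I_contractible G
| I_giso (G H : sgraph) : giso G H -> I_contractible G -> I_contractible H
| I_del_vertex (G : sgraph) (v : G) :
    I_contractible G -> I_contractible (induced (nbh v)) ->
    I_contractible (del_vertex v)
| I_add_vertex (G : sgraph) (v : G) :
    I_contractible (del_vertex v) -> I_contractible (induced (nbh v)) ->
    I_contractible G
| I_del_edge (G : sgraph) (v w : G) : adj v w ->
    I_contractible G -> I_contractible (induced (nbh2 v w)) ->
    I_contractible (del_edge v w)
| I_add_edge (G : sgraph) (v w : G) : adj v w ->
    I_contractible (del_edge v w) -> I_contractible (induced (nbh2 v w)) ->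
    I_contractible G.

Inductive I_transformation : sgraph -> sgraph -> Prop :=
| I1 (G : sgraph) (v : G) :
    I_contractible (induced (nbh v)) -> I_transformation G (del_vertex v)
| I2 (G : sgraph) (S : {set G}) :
    I_contractible (induced S) -> I_transformation G (add_vertex S)
| I3 (G : sgraph) (v w : G) : adj v w ->
    I_contractible (induced (nbh2 v w)) -> I_transformation G (del_edge v w)
| I4 (G : sgraph) (v w : G) : v != w -> ~~ adj v w ->
    I_contractible (induced (nbh2 v w)) -> I_transformation G (add_edge v w).

Definition I_homotopy_equiv : sgraph -> sgraph -> Prop :=
  clos_refl_trans sgraph (fun G H => I_transformation G H \/ giso G H).

(* Faces are nonempty and every point of the ground type is a vertex. *)
Record scomplex := SComplex {
  point :> finType;
  faces : {set {set point}};
  faces_neq0 : set0 \notin faces;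
  faces_down : forall s t : {set point},
    s \in faces -> t \subset s -> t != set0 -> t \in faces;
  faces_set1 : forall x : point, [set x] \in faces }.

Definition facet (X : scomplex) (s : {set X}) : Prop :=
  s \in faces X /\ forall t : {set X}, t \in faces X -> s \subset t -> t = s.

(* f identifies Y with the complex whose set of faces is F; when F = faces X,
   f is bijective since every point of X is a vertex. *)
Definition realizes (Y X : scomplex) (F : {set {set X}}) : Prop :=
  exists2 f : Y -> X, injective f & [set f @: s | s : {set Y} in faces Y] = F.

Definition ciso (X Y : scomplex) : Prop := realizes X (faces Y).

(* The cardinality condition is dim t = dim s - 1.  Collapsing may remove a
   point of X (when t is a vertex), hence the change of ground type. *)
Definition elementary_collapse (X Y : scomplex) : Prop :=
  exists t s : {set X},
    [/\ t \in faces X, facet s, t \subset s /\ #|s| = #|t|.+1,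
        forall r : {set X}, facet r -> t \subset r -> r = s
      & realizes Y (faces X :\ t :\ s)].

Definition simple_homotopy_equiv : scomplex -> scomplex -> Prop :=
  clos_refl_trans scomplex
    (fun X Y => [\/ elementary_collapse X Y, elementary_collapse Y X
                  | ciso X Y]).

Section CliqueComplex.
Variable G : sgraph.
Definition clique (S : {set G}) : bool :=
  [forall x in S, forall y in S, (x != y) ==> adj x y].
Definition clique_faces : {set {set G}} :=
  [set S : {set G} | (S != set0) && clique S].
Lemma clique_neq0 : set0 \notin clique_faces.
Proof. by rewrite inE eqxx. Qed.
Lemma clique_down (s t : {set G}) :
  s \in clique_faces -> t \subset s -> t != set0 -> t \in clique_faces.
Proof.
rewrite !inE => /andP[_ /forall_inP cs] /subsetP ts -> /=.
apply/forall_inP => x /ts xs; apply/forall_inP => y /ts ys.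
by have /forall_inP/(_ y ys) := cs x xs.
Qed.
Lemma clique_set1 (x : G) : [set x] \in clique_faces.
Proof.
rewrite inE; apply/andP; split; first by apply/set0Pn; exists x; rewrite inE.
apply/forall_inP => y /set1P ->; apply/forall_inP => z /set1P ->.
by rewrite eqxx.
Qed.
Definition clique_complex : scomplex :=
  SComplex clique_neq0 clique_down clique_set1.
End CliqueComplex.

(* Main.v *)
Require Import Defs.
Set Implicit Arguments.
Unset Strict Implicit.
Unset Printing Implicit Defensive.

(* Simple homotopy implies s-homotopy because an elementary collapse of X
   deletes two s-dismantlable vertices from the comparability graph of the faces
   of X, and this graph is s-homotopic to G when X = C(G).  Conversely, if the
   common neighbourhood of a clique c is dismantlable, C(G) collapses onto its
   subcomplex of cliques not containing c; for c = {v} this turns s-deletions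
   into collapses, and for c = {v, w} it shows, with the first implication, that
   deleting an edge with dismantlable common neighbourhood preserves the
   s-homotopy type.

   Since only fresh vertices are ever added to a graph, an s-homotopy from the
   link L of v to a point can be followed inside the ambient graph: dropping u
   from L deletes the edge {v, u}, and adding u to L adds a new vertex joined to
   v.  Hence a vertex whose link is s-homotopic to a point can be deleted up to
   s-homotopy.  Edge moves reduce to vertex moves by adding a twin of v that
   is not joined to w and then deleting v; so every I-transformation is an
   s-homotopy. *)

Lemma cliqueP (G : sgraph) (S : {set G}) :
  reflect {in S &, forall x y, x != y -> adj x y} (clique S).
Proof.
apply: (iffP forall_inP) => [h x y xS yS xy|h x xS].
  by have /forall_inP/(_ y yS)/implyP/(_ xy) := h x xS.
by apply/forall_inP => y yS; apply/implyP; apply: h.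
Qed.

Lemma clique_facesP (G : sgraph) (S : {set G}) :
  reflect (S != set0 /\ {in S &, forall x y, x != y -> adj x y})
          (S \in clique_faces G).
Proof. by rewrite inE; apply: (iffP andP) => -[h /cliqueP]. Qed.

Lemma giso_sym (G H : sgraph) : giso G H -> giso H G.
Proof.
case=> f [g fK gK] fa; exists g; first by exists f.
by move=> x y; rewrite -fa !gK.
Qed.

(* H is isomorphic to W[S]; vertex deletions and links are then subsets of the
   fixed graph W, and no iterated subtypes of induced subgraphs occur. *)
Definition emb (H W : sgraph) (S : {set W}) : Prop :=
  exists f : H -> W, [/\ injective f, forall x y, adj (f x) (f y) = adj x y
                       & f @: [set: H] = S].

Lemma emb_induced (W : sgraph) (S : {set W}) : emb (induced S) S.
Proof.
exists val; split=> //; first exact: val_inj.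
apply/setP=> y; apply/imsetP/idP => [[x _ ->]|yS]; first exact: (valP x).
by exists (Sub y yS).
Qed.

Lemma emb_imset (H W W' : sgraph) (S : {set W}) (f : W -> W') :
  injective f -> (forall x y, adj (f x) (f y) = adj x y) ->
  emb H S -> emb H (f @: S).
Proof.
move=> fi fa [g [gi ga <-]]; exists (f \o g); split.
- exact: inj_comp.
- by move=> x y /=; rewrite fa ga.
- by rewrite imset_comp.
Qed.

Lemma emb_setT (G : sgraph) : emb G [set: G].
Proof. by exists id; split=> //; apply: imset_id. Qed.

Lemma emb_giso (H H' W : sgraph) (S : {set W}) :
  emb H S -> emb H' S -> giso H H'.
Proof.
case=> f [fi fa fS] [g [gi ga gS]].
have /fin_all_exists[h hE] (x : H) : exists y, g y = f x.
  have : f x \in S by rewrite -fS imset_f.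
  by rewrite -gS => /imsetP[y _ ->]; exists y.
have /fin_all_exists[k kE] (x : H') : exists y, f y = g x.
  have : g x \in S by rewrite -gS imset_f.
  by rewrite -fS => /imsetP[y _ ->]; exists y.
exists h; last by move=> x y; rewrite -ga !hE fa.
by exists k => x; [apply: fi; rewrite kE hE | apply: gi; rewrite hE kE].
Qed.

Lemma giso_emb (H H' W : sgraph) (S : {set W}) :
  giso H H' -> emb H' S -> emb H S.
Proof.
case=> f [f' fK f'K] fa [g [gi ga <-]]; exists (g \o f); split.
- exact: inj_comp (can_inj fK).
- by move=> x y /=; rewrite ga fa.
- rewrite imset_comp; have -> // : f @: [set: H] = [set: H'].
  apply/setP=> y; rewrite inE.
  by apply/imsetP; exists (f' y); rewrite ?f'K.
Qed.

Lemma emb_del_vertex (W : sgraph) (S : {set W}) (v : W) (vS : v \in S) :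
  emb (@del_vertex (induced S) (Sub v vS)) (S :\ v).
Proof.
have -> : S :\ v = val @: [set~ (Sub v vS : induced S)].
  apply/setP=> x; rewrite !inE; apply/andP/imsetP => [[xv xS]|[y + ->]].
    by exists (Sub x xS); rewrite // !inE -val_eqE.
  by rewrite !inE -val_eqE /= => yv; split=> //; apply: (valP y).
by apply: emb_imset (emb_induced _); [apply: val_inj|].
Qed.

Lemma emb_nbh (W : sgraph) (S : {set W}) (v : W) (vS : v \in S) :
  emb (induced (@nbh (induced S) (Sub v vS))) (S :&: nbh v).
Proof.
have -> : S :&: nbh v = val @: @nbh (induced S) (Sub v vS).
  apply/setP=> x; rewrite !inE; apply/andP/imsetP => [[xS vx]|[y + ->]].
    by exists (Sub x xS); rewrite // !inE.
  by rewrite !inE /= => vy; split=> //; apply: (valP y).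
by apply: emb_imset (emb_induced _); [apply: val_inj|].
Qed.

Lemma emb_image_del_vertex (H W : sgraph) (f : H -> W) (v : H) :
  injective f -> (forall x y, adj (f x) (f y) = adj x y) ->
  emb (del_vertex v) (f @: [set: H] :\ f v).
Proof.
move=> fi fa; have -> : f @: [set: H] :\ f v = f @: [set~ v].
  apply/setP=> x; rewrite !inE; apply/andP/imsetP.
    by case=> xv /imsetP[y _ xy]; exists y; rewrite ?inE // -(inj_eq fi) -xy.
  by case=> y; rewrite !inE -(inj_eq fi) => yv ->; rewrite imset_f.
exact: emb_imset (emb_induced _).
Qed.

Lemma emb_image_nbh (H W : sgraph) (f : H -> W) (v : H) :
  injective f -> (forall x y, adj (f x) (f y) = adj x y) ->
  emb (induced (nbh v)) (f @: [set: H] :&: nbh (f v)).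
Proof.
move=> fi fa; have -> : f @: [set: H] :&: nbh (f v) = f @: nbh v.
  apply/setP=> x; rewrite !inE; apply/andP/imsetP.
    by case=> /imsetP[y _ ->]; rewrite fa => vy; exists y; rewrite ?inE.
  by case=> y; rewrite !inE => vy ->; rewrite imset_f // fa.
exact: emb_imset (emb_induced _).
Qed.

(** * Dismantlable vertex sets *)

Inductive dsm (W : sgraph) : {set W} -> Prop :=
| dsm_set1 x : dsm [set x]
| dsm_del (S : {set W}) v w : v \in S -> w \in S -> w != v ->
    S :&: cnbh v \subset cnbh w -> dsm (S :\ v) -> dsm S.

Lemma dsm_emb (W : sgraph) (S : {set W}) (H : sgraph) :
  dsm S -> emb H S -> dismantlable H.
Proof.
move=> dS; elim: dS H => {S} [x|S v w vS wS wv dom _ IH] H [f [fi fa fS]].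
  by apply: dismantlable_one; rewrite -cardsT -(card_imset _ fi) fS cards1.
have [v' _ vE] : exists2 x, x \in [set: H] & v = f x.
  by apply/imsetP; rewrite fS.
have [w' _ wE] : exists2 x, x \in [set: H] & w = f x.
  by apply/imsetP; rewrite fS.
apply: (@dismantlable_del _ v').
  exists w'; first by rewrite -(inj_eq fi) -vE -wE.
  apply/subsetP => u; rewrite !inE => uv.
  have /subsetP/(_ (f u)) := dom.
  rewrite !inE vE wE !(inj_eq fi) !fa uv -fS imset_f //; exact.
apply: IH; rewrite vE -fS; exact: emb_image_del_vertex.
Qed.

Lemma emb_dsm (W : sgraph) (S : {set W}) (H : sgraph) :
  dismantlable H -> emb H S -> dsm S.
Proof.
move=> dH; elim: dH W S => {H} [H H1|H v [w wv dom] _ IH] W S [f [fi fa <-]].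
  have /eqP/cards1P[x ->] : #|f @: [set: H]| = 1.
    by rewrite card_imset // cardsT.
  exact: dsm_set1.
apply: (@dsm_del _ _ (f v) (f w)); rewrite ?imset_f ?inj_eq //.
  apply/subsetP => x; rewrite !inE => /andP[/imsetP[u _ ->]].
  rewrite !(inj_eq fi) !fa => uv.
  by have /subsetP/(_ u) := dom; rewrite !inE; apply.
by apply: IH; apply: emb_image_del_vertex.
Qed.

Lemma dismantlable_dsm (W : sgraph) (S : {set W}) :
  dismantlable (induced S) <-> dsm S.
Proof.
by split=> d; [apply: emb_dsm d _ | apply: dsm_emb d _]; apply: emb_induced.
Qed.

Lemma dsm_shrink (W : sgraph) (A S : {set W}) :
  (forall U : {set W}, A \proper U -> U \subset S ->
     exists v w, [/\ v \in U :\: A, w \in U, w != v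
                   & U :&: cnbh v \subset cnbh w]) ->
  A \subset S -> dsm A -> dsm S.
Proof.
move=> step; have [n] := ubnP #|S|; elim: n S step => // n IH S step.
move=> leSn AS dA; have [-> //|nAS] := eqVneq S A.
have [|//|v [w [+ wS wv dom]]] := step S; first by rewrite properEneq eq_sym nAS.
rewrite inE => /andP[vA vS].
apply: (dsm_del vS wS wv dom); apply: IH => //.
- by move=> U AU US; apply: step => //; apply: subset_trans US (subsetDl _ _).
- by rewrite (cardsD1 v S) vS in leSn.
- by rewrite subsetD1 AS vA.
Qed.

Lemma dsm_cone (W : sgraph) (S : {set W}) (w : W) :
  w \in S -> {in S, forall u, u != w -> adj w u} -> dsm S.
Proof.
move=> wS cone; apply: (@dsm_shrink _ [set w]); last exact: dsm_set1.
  move=> U wU US; have /properP[/subsetP wU' [v vU vw]] := wU.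
  exists v, w; split; rewrite ?inE //.
  - by move: vw; rewrite inE vU andbT.
  - by apply: wU'; rewrite inE.
  - by rewrite eq_sym; move: vw; rewrite inE.
  apply/subsetP => u; rewrite !inE => /andP[uU _].
  by case: eqVneq => //= ?; apply: cone => //; apply: (subsetP US).
by rewrite sub1set.
Qed.

(** * s-homotopy *)

Local Notation shom := s_homotopy_equiv.

Lemma shom_refl G : shom G G. Proof. exact: rt_refl. Qed.

Lemma shom_trans G H K : shom G H -> shom H K -> shom G K.
Proof. exact: rt_trans. Qed.

Lemma shom_sym G H : shom G H -> shom H G.
Proof.
elim=> {G H} [G H|G|G H K _ h1 _ h2]; last exact: shom_trans h2 h1.
  case=> h; apply: rt_step; [exact: Or32 | exact: Or31 | ].
  by apply: Or33; apply: giso_sym.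
exact: shom_refl.
Qed.

Lemma giso_shom G H : giso G H -> shom G H.
Proof. by move=> h; apply: rt_step; apply: Or33. Qed.

Lemma emb_shom H H' (W : sgraph) (S : {set W}) : emb H S -> emb H' S -> shom H H'.
Proof. by move=> h h'; apply: giso_shom; apply: emb_giso h h'. Qed.

Lemma shom_delete (W : sgraph) (S : {set W}) (v : W) :
  v \in S -> dsm (S :&: nbh v) -> shom (induced S) (induced (S :\ v)).
Proof.
move=> vS d; apply: (@shom_trans _ (@del_vertex (induced S) (Sub v vS))).
  apply: rt_step; apply: Or31; apply: SDeletion.
  exact: dsm_emb d (emb_nbh _).
exact: emb_shom (emb_del_vertex _) (emb_induced _).
Qed.

Lemma shom_shrink (W : sgraph) (A S : {set W}) :
  (forall U : {set W}, A \proper U -> U \subset S ->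
     exists2 v, v \in U :\: A & dsm (U :&: nbh v)) ->
  A \subset S -> shom (induced S) (induced A).
Proof.
move=> step; have [n] := ubnP #|S|; elim: n S step => // n IH S step.
move=> leSn AS; have [-> //|nAS] := eqVneq S A; first exact: shom_refl.
have [|//|v] := step S; first by rewrite properEneq eq_sym nAS.
rewrite inE => /andP[vA vS] d.
apply: shom_trans (shom_delete vS d) _; apply: IH => //.
- by move=> U AU US; apply: step => //; apply: subset_trans US (subsetDl _ _).
- by rewrite (cardsD1 v S) vS in leSn.
- by rewrite subsetD1 AS vA.
Qed.

(** * Barycentric subdivision *)

Definition comparable_adj (T : finType) : rel {set T} :=
  fun s t => (s \proper t) || (t \proper s).

Lemma comparable_sym (T : finType) : symmetric (@comparable_adj T).
Proof. by move=> s t; rewrite /comparable_adj orbC. Qed.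

Lemma comparable_irr (T : finType) : irreflexive (@comparable_adj T).
Proof. by move=> s; rewrite /comparable_adj properxx. Qed.

Definition comparability_graph (T : finType) : sgraph :=
  SGraph (@comparable_sym T) (@comparable_irr T).

Definition subdivision (X : scomplex) : sgraph :=
  @induced (comparability_graph X) (faces X).

Lemma realizes_emb (Y X : scomplex) (F : {set {set X}}) :
  realizes Y F -> @emb (subdivision Y) (comparability_graph X) F.
Proof.
case=> f fi <-.
apply: (@emb_imset _ (comparability_graph Y) (comparability_graph X) _
          (fun s : {set Y} => f @: s)).
- exact: imset_inj.
- have fS (s t : {set Y}) : (f @: s \proper f @: t) = (s \proper t).
    have sub (a b : {set Y}) : (f @: a \subset f @: b) = (a \subset b).
      apply/idP/idP => [/subsetP h|]; last exact: imsetS.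
      by apply/subsetP => x /(imset_f f)/h; rewrite mem_imset.
    by rewrite !properE !sub.
  by move=> s t; rewrite /= /comparable_adj !fS.
- exact: emb_induced.
Qed.

Lemma exists_facet (X : scomplex) (s : {set X}) :
  s \in faces X -> exists2 t, facet t & s \subset t.
Proof.
move=> sX.
have sP : (s \in faces X) && (s \subset s) by rewrite sX subxx.
case: (arg_maxnP (P := fun t => (t \in faces X) && (s \subset t))
                 (fun t : {set X} => #|t|) sP) => t /andP[tX st] tmax.
exists t => //; split=> // u uX tu; apply/eqP.
by rewrite eq_sym eqEcard tu; apply: tmax; rewrite uX (subset_trans st).
Qed.

(* A set s of S that misses x is dominated by x |: s; when those are removed
   in order of decreasing size, [set x] is adjacent to all the rest. *)
Lemma dsm_faces_around (T : finType) (x : T)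
    (S : {set comparability_graph T}) :
  [set x] \in S -> {in S, forall s, x |: s \in S} -> set0 \notin S -> dsm S.
Proof.
move=> xS Sx S0; pose A : {set comparability_graph T} := [set s in S | x \in s].
apply: (@dsm_shrink _ A); first 1 last.
- by apply/subsetP => s; rewrite inE => /andP[].
- apply: (@dsm_cone (comparability_graph T) _ [set x]); first by rewrite inE xS set11.
  move=> s; rewrite inE => /andP[_ xs] sx; apply/orP; left.
  by rewrite properEneq eq_sym sx sub1set.
move=> U AU US; have /properP[/subsetP AU' [s0 s0U s0A]] := AU.
have P0 : (s0 \in U) && (s0 \notin A) by rewrite s0U.
case: (arg_maxnP (P := fun s => (s \in U) && (s \notin A))
        (fun s : {set T} => #|s|) P0) => s /andP[sU sA] smax.
have sS : s \in S by apply: (subsetP US).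
have xs : x \notin s by move: sA; rewrite inE sS.
have xsU : (x |: s) \in U.
  by apply: AU'; rewrite inE Sx //= setU11.
have ps : s \proper x |: s by rewrite properE subsetUr subUset sub1set (negbTE xs).
exists s, (x |: s); split=> //.
- by rewrite in_setD sU sA.
- by rewrite eq_sym; apply: contraTneq ps => {1}->; rewrite properxx.
apply/subsetP => t; rewrite !inE => /andP[tU].
case/or3P=> [/eqP->|st|ts]; first by rewrite /= /comparable_adj ps !orbT.
- have xt : x \in t.
    apply: contraLR (proper_card st) => xt; rewrite -leqNgt.
    by apply: smax; rewrite tU inE (negbTE xt) andbF.
  have /andP[sst _] := st.
  have xst : x |: s \subset t by rewrite subUset sub1set xt.
  by case: eqVneq => //= ne; rewrite /comparable_adj properEneq eq_sym ne xst.
- by rewrite /= /comparable_adj (proper_trans ts ps) !orbT.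
Qed.

Lemma collapse_shom (X Y : scomplex) :
  elementary_collapse X Y -> shom (subdivision X) (subdivision Y).
Proof.
case=> t [s [tX sf [ts card_s] uniq_s rY]].
have [sX smax] := sf.
have st : s != t.
  by apply: contra_eq_neq card_s => ->; rewrite ltn_eqF.
have pts : t \proper s by rewrite properEneq eq_sym st.
pose W := comparability_graph X; pose F : {set W} := faces X.
have above r : r \in faces X -> t \proper r -> r = s.
  move=> rX tr; have [r' r'f rr'] := exists_facet rX.
  have e := uniq_s _ r'f (subset_trans (proper_sub tr) rr').
  rewrite e in rr'; apply/eqP; rewrite eqEcard rr' card_s.
  exact: proper_card.
apply: (@shom_trans _ (@induced W (F :\ t))).
  apply: shom_delete => //; apply: (@dsm_cone W _ s).
    by rewrite !inE sX /= /comparable_adj pts.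
  move=> r; rewrite !inE => /andP[rX] /orP[tr|rt] rs.
    by rewrite (above r) // eqxx in rs.
  by rewrite /= /comparable_adj (proper_trans rt pts) orbT.
apply: (@shom_trans _ (@induced W (F :\ t :\ s))); last first.
  exact: emb_shom (emb_induced _) (realizes_emb rY).
have sF : s \in F :\ t by rewrite !inE st.
apply: shom_delete => //.
have [x xs xt] : exists2 x, x \in s & x \notin t.
  by have /properP[_] := pts.
have below r : r \in faces X -> (r != t) -> r \proper s -> x |: r \proper s.
  move=> rX rt rs; rewrite properEneq subUset sub1set xs (proper_sub rs) !andbT.
  have [xr|xr] := boolP (x \in r).
    apply: contraTneq rs => <-; rewrite properE negb_and negbK subUset.
    by rewrite sub1set xr subxx orbT.
  apply/eqP => e; have tr : t \subset r.
    apply/subsetP => y yt; have : y \in x |: r by rewrite e (subsetP ts).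
    by rewrite !inE => /orP[/eqP yx|//]; rewrite yx (negbTE xt) in yt.
  move/negP: rt; apply; rewrite eq_sym eqEcard tr -ltnS -card_s -e cardsU1 xr.
  by rewrite leqnn.
have t0 : 0 < #|t|.
  by rewrite card_gt0; apply: contraTneq tX => ->; rewrite faces_neq0.
have inS (r : W) : (r \in (F :\ (t : W)) :&: @nbh W s) =
    [&& r \in faces X, r != t & r \proper s].
  rewrite !inE /= /comparable_adj andbC; case rX: (r \in faces X); rewrite ?andbF //=.
  rewrite andbC andbT; congr andb; have [sr|//] := boolP (s \proper r).
  by have := smax r rX (proper_sub sr) => rs; rewrite rs properxx in sr.
apply: (@dsm_faces_around _ x).
- rewrite inS faces_set1 /=; apply/andP; split.
    by apply: contraNneq xt => <-; rewrite set11.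
  by rewrite properEcard sub1set xs cards1 card_s.
- move=> r; rewrite !inS => /and3P[rX rt rs]; have h := below r rX rt rs.
  rewrite h andbT; apply/andP; split.
    apply: faces_down sX (proper_sub h) _.
    by apply/set0Pn; exists x; rewrite setU11.
  by apply: contraNneq xt => <-; rewrite setU11.
- by rewrite inS (negbTE (faces_neq0 X)).
Qed.

Lemma simple_homotopy_shom (X Y : scomplex) :
  simple_homotopy_equiv X Y -> shom (subdivision X) (subdivision Y).
Proof.
elim=> {X Y} [X Y|X|X Y Z _ h1 _ h2]; last exact: shom_trans h1 h2.
  case=> h; first exact: collapse_shom.
    by apply: shom_sym; apply: collapse_shom.
  exact: emb_shom (realizes_emb h) (emb_induced _).
exact: shom_refl.
Qed.

Section CliqueSubdivision.
Variable G : sgraph.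

(* Contains both G and its subdivision; a vertex and a face are adjacent when
   they span a clique. *)
Definition interpolation_adj : rel (G + {set G}) := fun p q =>
  match p, q with
  | inl x, inl y => adj x y
  | inl x, inr s => x |: s \in clique_faces G
  | inr s, inl x => x |: s \in clique_faces G
  | inr s, inr t => comparable_adj s t
  end.

Lemma interpolation_sym : symmetric interpolation_adj.
Proof. by move=> [x|s] [y|t] //=; [apply: adj_sym | apply: comparable_sym]. Qed.

Lemma interpolation_irr : irreflexive interpolation_adj.
Proof. by move=> [x|s] /=; [apply: adj_irr | apply: comparable_irr]. Qed.

Definition interpolation : sgraph :=
  SGraph interpolation_sym interpolation_irr.

Let vertices : {set interpolation} := inl @: [set: G].
Let simplices : {set interpolation} := inr @: clique_faces G.

Let inVertices p : p \in vertices = if p is inl _ then true else false.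
Proof.
case: p => [x|s]; first by rewrite mem_imset ?inE // => ? ? [].
by apply/imsetP => -[].
Qed.

Let inSimplices p :
  p \in simplices = if p is inr s then s \in clique_faces G else false.
Proof.
case: p => [x|s]; first by apply/imsetP => -[].
by rewrite mem_imset // => ? ? [].
Qed.

Let interpolation_vertices :
  shom (induced (vertices :|: simplices)) (induced vertices).
Proof.
apply: shom_shrink; last exact: subsetUl.
move=> U AU US; have /properP[/subsetP AU' [p pU pA]] := AU.
case: p pU pA => [x|s0]; rewrite inVertices // => s0U _.
pose P (s : {set G}) := (inr s : interpolation) \in U.
case: (arg_minnP (P := P) (fun s : {set G} => #|s|) s0U) => s sU smin.
have := subsetP US _ sU; rewrite inE inVertices inSimplices /= => sF.
have /clique_facesP[/set0Pn[y ys] cs] := sF.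
exists (inr s); first by rewrite inE inVertices.
have yU : (inl y : interpolation) \in U by apply: AU'; rewrite inVertices.
apply: (@dsm_cone interpolation _ (inl y)).
  by rewrite !inE yU /= (setUidPr _) ?sub1set // inE in sF *.
case=> [x|t]; rewrite in_setI => /andP[xU]; rewrite inE /=.
  move/clique_facesP => [_ cx] xy; apply: cx; rewrite ?setU11 ?setU1r //.
  by apply: contraNneq xy => ->.
have := subsetP US _ xU; rewrite inE inVertices inSimplices => tF.
case/orP=> [st|ts] _; last first.
  by have := smin t xU; rewrite leqNgt proper_card.
by rewrite (setUidPr _) // sub1set (subsetP (proper_sub st)).
Qed.

Let interpolation_simplices :
  shom (induced (vertices :|: simplices)) (induced simplices).
Proof.
apply: shom_shrink; last exact: subsetUr.
move=> U AU US; have /properP[/subsetP AU' [p pU pA]] := AU.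
have : p \in vertices :|: simplices by apply: (subsetP US).
rewrite inE (negbTE pA) orbF; case: p pU pA => [x|s]; last by rewrite inVertices.
move=> xU xA _; exists (inl x : interpolation); first by rewrite inE xA.
have UF s : (inr s : interpolation) \in U = (s \in clique_faces G).
  apply/idP/idP => h; last by apply: AU'; rewrite inSimplices.
  by have := subsetP US _ h; rewrite inE inVertices inSimplices.
have around s : s \in clique_faces G -> x \in s -> x |: s \in clique_faces G.
  by move=> sF xs; rewrite (setUidPr _) ?sub1set.
pose A : {set interpolation} := [set p in U :&: nbh (inl x : interpolation) |
  if p is inr s then x \in s else true].
have inA p : p \in A = if p is inr s then (s \in clique_faces G) && (x \in s)
                       else (p \in U :&: nbh (inl x : interpolation)).
  rewrite inE; case: p => [y|s]; rewrite ?andbT // in_setI UF.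
  rewrite -andbA andbCA [X in X && _]inE /=.
  case sF: (s \in _); rewrite ?andbF //=; case xs: (x \in s); rewrite ?andbF //=.
  by rewrite around.
apply: (@dsm_shrink _ A); first 1 last.
- by apply/subsetP => p; rewrite inE => /andP[].
- apply: (@dsm_cone interpolation _ (inr [set x])); first by rewrite inA clique_set1 set11.
  case=> [y|s]; rewrite inA.
    rewrite in_setI => /andP[_]; rewrite inE /= => xy _.
    apply/clique_facesP; split; first by apply/set0Pn; exists y; rewrite setU11.
    move=> a b; rewrite !inE => /orP[]/eqP-> /orP[]/eqP->; rewrite ?eqxx //.
    by rewrite adj_sym.
  move=> /andP[_ xs] sx; apply/orP; left; rewrite properEneq sub1set xs andbT.
  by apply: contraNneq sx => ->.
move=> V AV VU; have /properP[/subsetP AV' [p pV pA]] := AV.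
case: p pV pA => [y|s0] pV pA.
  by move: pA; rewrite inA (subsetP VU).
pose P (s : {set G}) := ((inr s : interpolation) \in V) && ((inr s : interpolation) \notin A).
have P0 : P s0 by rewrite /P pV.
case: (arg_maxnP (P := P) (fun s : {set G} => #|s|) P0) => s /andP[sV sA] smax.
have := subsetP VU _ sV; rewrite in_setI UF => /andP[sF]; rewrite inE /= => xsF.
have xs : x \notin s by move: sA; rewrite inA sF.
have ps : s \proper x |: s by rewrite properE subsetUr subUset sub1set (negbTE xs).
exists (inr s), (inr (x |: s)); split.
- by rewrite in_setD sV sA.
- by apply: AV'; rewrite inA xsF setU11.
- by apply: contraTneq ps => -[->]; rewrite properxx.
apply/subsetP; case=> [y|t]; rewrite in_setI => /andP[yV]; rewrite !inE /=.
  move=> /clique_facesP[_ ysF].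
  have := subsetP VU _ yV; rewrite in_setI => /andP[_]; rewrite inE /= => xy.
  apply/clique_facesP; split; first by apply/set0Pn; exists y; rewrite setU11.
  have /clique_facesP[_ xsC] := xsF.
  move=> a b; rewrite !in_setU1.
  case/or3P=> [/eqP->|/eqP->|aS] /or3P[/eqP->|/eqP->|bS] ab //;
    rewrite ?eqxx // in ab *; rewrite 1?adj_sym //;
    by [apply: ysF; rewrite ?inE ?eqxx ?aS ?bS ?orbT // 1?eq_sym
       | apply: xsC; rewrite ?inE ?eqxx ?aS ?bS ?orbT // 1?eq_sym].
case/or3P=> [/eqP[->]|st|ts]; first by rewrite /comparable_adj ps !orbT.
- have xt : x \in t.
    apply: contraLR (proper_card st) => xt; rewrite -leqNgt.
    by apply: smax; rewrite /P yV inA (negbTE xt) andbF.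
  have xst : x |: s \subset t by rewrite subUset sub1set xt (proper_sub st).
  have [->|ne] := eqVneq t (x |: s); first by rewrite eqxx.
  by apply/orP; right; rewrite /comparable_adj properEneq eq_sym ne xst.
- by rewrite /comparable_adj (proper_trans ts ps) !orbT.
Qed.

Lemma clique_subdivision_shom : shom G (subdivision (clique_complex G)).
Proof.
apply: (@shom_trans _ (induced vertices)).
  apply: (@emb_shom _ _ _ vertices); last exact: emb_induced.
  by apply: emb_imset (emb_setT G) => // ? ? [].
apply: shom_trans (shom_sym interpolation_vertices) _.
apply: shom_trans interpolation_simplices _.
apply: emb_shom (emb_induced _) _.
apply: (@emb_imset _ (comparability_graph G) interpolation _ inr) => //.
  by move=> ? ? [].
exact: emb_induced.
Qed.
End CliqueSubdivision.

Theorem clique_simple_shom (G H : sgraph) :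
  simple_homotopy_equiv (clique_complex G) (clique_complex H) -> shom G H.
Proof.
move=> /simple_homotopy_shom h.
apply: shom_trans (clique_subdivision_shom G) _; apply: shom_trans h _.
exact: shom_sym (clique_subdivision_shom H).
Qed.

(** * Collapses of clique complexes *)

Local Notation simple := simple_homotopy_equiv.

Lemma simple_refl X : simple X X. Proof. exact: rt_refl. Qed.

Lemma simple_trans X Y Z : simple X Y -> simple Y Z -> simple X Z.
Proof. exact: rt_trans. Qed.

Lemma realizes_faces (X : scomplex) : realizes X (faces X).
Proof.
exists id => //; apply/setP=> s; apply/imsetP/idP => [[t tX ->]|sX].
  by rewrite imset_id.
by exists s => //; rewrite imset_id.
Qed.

Lemma realizes_subset (X Y Y' : scomplex) (F F' : {set {set X}}) (f : Y -> X) :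
  injective f -> [set f @: s | s : {set Y} in faces Y] = F ->
  realizes Y' F' -> F' \subset F ->
  realizes Y' [set s in faces Y | f @: s \in F'].
Proof.
move=> fi fF [f' f'i f'F] /subsetP FF.
have /fin_all_exists[g gE] (y : Y') : exists x, f x = f' y.
  have : [set f' y] \in F.
    by apply: FF; rewrite -f'F -imset_set1 imset_f // faces_set1.
  rewrite -fF => /imsetP[s _ e]; have : f' y \in f @: s by rewrite -e set11.
  by case/imsetP => x _ ->; exists x.
have gim (s : {set Y'}) : f @: (g @: s) = f' @: s.
  by rewrite -imset_comp; apply: eq_imset => y /=.
exists g; first by move=> x y /(congr1 f); rewrite !gE => /f'i.
apply/setP=> s; rewrite inE; apply/imsetP/andP => [[t tY ->]|[sY sF]].
  rewrite gim; have f't : f' @: t \in F' by rewrite -f'F imset_f.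
  split=> //; have := FF _ f't; rewrite -fF -gim => /imsetP[u uY].
  by move/(imset_inj fi) ->.
move: sF; rewrite -f'F => /imsetP[t tY]; rewrite -gim => /(imset_inj fi) ->.
by exists t.
Qed.

Lemma realizes_unique (X Y Y' : scomplex) (F : {set {set X}}) :
  realizes Y F -> realizes Y' F -> simple Y Y'.
Proof.
move=> rY [f fi fF]; apply: rt_step; apply: Or33.
have := realizes_subset fi fF rY (subxx _).
rewrite /ciso; congr realizes; apply/setP=> s; rewrite inE.
by case sY: (s \in _); rewrite // -fF imset_f.
Qed.

Lemma realizes_collapse (X Y Y' : scomplex) (F : {set {set X}}) (t s : {set X}) :
  realizes Y F -> realizes Y' (F :\ t :\ s) ->
  t \in F -> s \in F -> t \subset s -> #|s| = #|t|.+1 ->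
  {in F, forall r : {set X}, s \subset r -> r = s} ->
  {in F, forall r : {set X}, t \subset r -> r = t \/ r = s} ->
  elementary_collapse Y Y'.
Proof.
case=> f fi fF rY' tF sF ts card_s smax tmax.
have inF (r : {set Y}) : (f @: r \in F) = (r \in faces Y).
  by rewrite -fF mem_imset //; apply: imset_inj.
have sub (a b : {set Y}) : (f @: a \subset f @: b) = (a \subset b).
  apply/idP/idP => [/subsetP h|]; last exact: imsetS.
  by apply/subsetP => x /(imset_f f)/h; rewrite mem_imset.
move: (tF) (sF); rewrite -{1 2}fF => /imsetP[t' t'Y tE] /imsetP[s' s'Y sE].
have ts' : t' \subset s' by rewrite -sub -tE -sE.
have card_s' : #|s'| = #|t'|.+1.
  by rewrite -(card_imset _ fi) -sE card_s tE (card_imset _ fi).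
have sf : facet s'.
  split=> // r rY s'r; apply: (imset_inj fi); rewrite -sE; apply: smax.
    by rewrite inF.
  by rewrite sE sub.
exists t', s'; split=> //.
  move=> r [rY rmax] t'r; apply: (imset_inj fi); rewrite -sE.
  have [|||//] := tmax (f @: r); rewrite ?inF ?tE ?sub //.
  move/(imset_inj fi) => rt; have := rmax s' s'Y; rewrite rt => /(_ ts') e.
  by move: card_s'; rewrite e => /eqP; rewrite ltn_eqF.
have := realizes_subset fi fF rY' (subset_trans (subsetDl _ _) (subsetDl _ _)).
congr realizes; apply/setP=> r; rewrite !inE tE sE !(inj_eq (imset_inj fi)) inF.
by case: (r \in faces Y); rewrite ?andbF ?andbT.
Qed.

Lemma exists_realization (X : scomplex) (F : {set {set X}}) :
  set0 \notin F ->
  (forall s t : {set X}, s \in F -> t \subset s -> t != set0 -> t \in F) ->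
  exists Y, realizes Y F.
Proof.
move=> F0 Fdown; pose V := {x : X | [set x] \in F}.
pose E := [set s : {set V} | val @: s \in F].
have E0 : set0 \notin E by rewrite inE imset0.
have Edown (s t : {set V}) : s \in E -> t \subset s -> t != set0 -> t \in E.
  rewrite !inE => sF ts t0; apply: Fdown sF (imsetS _ ts) _.
  by rewrite imset_eq0.
have E1 (x : V) : [set x] \in E by rewrite inE imset_set1 (valP x).
exists (SComplex E0 Edown E1), val; first exact: val_inj.
apply/setP=> s; apply/imsetP/idP => [[t + ->]|sF]; first by rewrite inE.
have sE : val @: [set x : V | val x \in s] = s.
  apply/setP=> x; apply/imsetP/idP => [[y + ->]|xs]; first by rewrite inE.
  have xF : [set x] \in F.
    apply: Fdown sF _ _; first by rewrite sub1set.
    by apply/set0Pn; exists x; rewrite set11.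
  by exists (Sub x xF); rewrite ?inE.
by exists [set x : V | val x \in s]; rewrite ?inE sE.
Qed.

(* The pairs (s - y, s) with s in A are removed in order of decreasing size. *)
Lemma collapse_matching (X : scomplex) (y : X) (A F : {set {set X}})
    (Y Y' : scomplex) :
  set0 \notin F ->
  (forall s t : {set X}, s \in F -> t \subset s -> t != set0 -> t \in F) ->
  A \subset F ->
  (forall s t : {set X}, s \in A -> t \in F -> s \subset t -> t \in A) ->
  {in A, forall s, y |: s \in A /\ s :\ y \in A} ->
  realizes Y F -> realizes Y' (F :\: A) -> simple Y Y'.
Proof.
have [n] := ubnP #|A|; elim: n A F Y => // n IH A F Y leAn.
move=> F0 Fdown AF Aup Ay rY rY'.
have [A0|[s0 s0A]] := set_0Vmem A.
  by rewrite A0 setD0 in rY'; apply: realizes_unique rY rY'.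
case: (arg_maxnP (P := mem A) (fun s : {set X} => #|s|) s0A) => s.
rewrite -[mem A s]/(s \in A) => sA smax.
have ys : y \in s.
  apply: contraT => ys; have [/smax + _] := Ay s sA.
  by rewrite /= cardsU1 ys add1n ltnn.
have sF := subsetP AF _ sA; have [_ tA] := Ay s sA.
have tF := subsetP AF _ tA.
have top r : r \in F -> s \subset r -> r = s.
  by move=> rF sr; apply/eqP; rewrite eq_sym eqEcard sr; apply: smax; apply: Aup rF sr.
have free r : r \in F -> s :\ y \subset r -> r = s :\ y \/ r = s.
  move=> rF tr; have rA := Aup _ _ tA rF tr.
  have [yrA _] := Ay r rA.
  have yrs : y |: r = s.
    apply: top; first exact: (subsetP AF).
    by rewrite -(setD1K ys) setUS.
  have [yr|yr] := boolP (y \in r); last by left; rewrite -yrs setU1K.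
  by right; rewrite -yrs (setUidPr _) ?sub1set.
pose F' := F :\ (s :\ y) :\ s.
have F'0 : set0 \notin F' by rewrite !inE (negbTE F0) !andbF.
have F'down (r u : {set X}) : r \in F' -> u \subset r -> u != set0 -> u \in F'.
  rewrite !inE => /and3P[rs rt rF] ur u0; have uF := Fdown _ _ rF ur u0.
  rewrite uF andbT; apply/andP; split.
    by apply: contraNneq rs => us; rewrite us in ur; apply/eqP; apply: top.
  apply: contraTneq ur => ->; apply/negP => /(free r rF)[]/eqP.
    by rewrite (negbTE rt).
  by rewrite (negbTE rs).
have [Z rZ] := exists_realization F'0 F'down.
apply: (@simple_trans _ Z).
  apply: rt_step; apply: Or31; apply: (realizes_collapse rY rZ) => //.
    exact: subsetDl.
  by rewrite (cardsD1 y s) ys.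
apply: (IH (A :\ (s :\ y) :\ s) F') => //.
- have : #|A :\ (s :\ y) :\ s| < #|A|.
    apply: proper_card; apply/properP; split.
      exact: subset_trans (subsetDl _ _) (subsetDl _ _).
    by exists s => //; rewrite !inE eqxx.
  by move=> h; apply: leq_trans h _.
- by rewrite !setSD.
- move=> r u; rewrite !inE => /and3P[_ _ rA] /and3P[-> -> uF] /= ru.
  exact: Aup rA uF ru.
- move=> r; rewrite !inE => /and3P[rs rt rA]; have [yrA tyA] := Ay r rA.
  have nrs : y |: r != s.
    apply/eqP => e; have [yr|yr] := boolP (y \in r).
      by rewrite -e (setUidPr _) ?sub1set ?eqxx in rs.
    by rewrite -e setU1K ?eqxx in rt.
  have nrt : r :\ y != s :\ y.
    apply: contraNneq nrs => e; rewrite -(setD1K ys) -e.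
    by apply/eqP/setP=> x; rewrite !inE; case: (x == y).
  rewrite yrA tyA nrs nrt !andbT; split.
    by apply: contraTneq (setU11 y r) => ->; rewrite !inE eqxx.
  by apply: contraTneq ys => <-; rewrite !inE eqxx.
- move: rY'; congr realizes; apply/setP=> r; rewrite !inE.
  have [->|_] := eqVneq r s; first by rewrite sA !andbF.
  by have [->|//] := eqVneq r (s :\ y); rewrite tA !andbF.
Qed.

Lemma collapse_open_star (X : scomplex) (F : {set {set X}}) (d : {set X}) (y : X)
    (Y Y' : scomplex) :
  set0 \notin F ->
  (forall s t : {set X}, s \in F -> t \subset s -> t != set0 -> t \in F) ->
  d != set0 -> y \notin d ->
  {in F, forall s : {set X}, d \subset s -> y |: s \in F} ->
  realizes Y F -> realizes Y' [set s in F | ~~ (d \subset s)] -> simple Y Y'.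
Proof.
move=> F0 Fdown d0 yd Fy rY rY'.
apply: (@collapse_matching X y [set s in F | d \subset s] F) => //.
- by apply/subsetP => s; rewrite inE => /andP[].
- by move=> s t; rewrite !inE => /andP[_ ds] -> /(subset_trans ds).
- move=> s; rewrite inE => /andP[sF ds]; have dsy : d \subset s :\ y.
    by rewrite subsetD1 ds.
  rewrite !inE Fy // (subset_trans ds (subsetUr _ _)) dsy.
  split=> //; rewrite andbT; apply: Fdown sF (subsetDl _ _) _.
  by apply: contraNneq d0 => e; rewrite e subset0 in dsy.
- by move: rY'; congr realizes; apply/setP=> s; rewrite !inE;
    case: (s \in F); rewrite ?andbF ?andbT.
Qed.

Lemma collapse_clique_star (G : sgraph) (c T : {set G}) (Y Y' : scomplex) :
  c != set0 -> dsm T -> {in c & T, forall x z, adj x z} ->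
  @realizes Y (clique_complex G)
    [set s in clique_faces G | (c \subset s) ==> (s \subset c :|: T)] ->
  @realizes Y' (clique_complex G) [set s in clique_faces G | ~~ (c \subset s)] ->
  simple Y Y'.
Proof.
move=> c0 dT; pose X := clique_complex G.
pose F (U : {set G}) : {set {set X}} :=
  [set s in clique_faces G | (c \subset s) ==> (s \subset c :|: U)].
have F0 U : set0 \notin F U by rewrite !inE eqxx.
have Fdown U (s t : {set X}) :
    s \in F U -> t \subset s -> t != set0 -> t \in F U.
  rewrite ![_ \in F _]inE => /andP[sX sU] ts t0.
  rewrite (clique_down sX ts t0); apply/implyP => ct.
  by apply: (subset_trans ts); apply: (implyP sU); apply: subset_trans ts.
have disj (U : {set G}) y : {in c & U, forall x z, adj x z} -> y \in U -> y \notin c.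
  by move=> cU yU; apply/negP => yc; have := cU y y yc yU; rewrite adj_irr.
elim: dT Y => {T} [y|T v w vT wT wv dom _ IH] Y cT rY rY'.
  apply: (@collapse_open_star X _ c y _ _ (F0 [set y]) (@Fdown _)) => //.
  - exact: (disj [set y] y cT (set11 y)).
  - move=> s; rewrite ![_ \in F _]inE => /andP[/clique_facesP[s0 sC] /implyP scy] cs.
    have {}scy := scy cs; apply/andP; split; last first.
      by apply/implyP => _; rewrite subUset subsetUr.
    have adjy a : a \in s -> a != y -> adj a y.
      move=> /(subsetP scy); rewrite !inE => /orP[ac _|->//].
      by apply: cT; rewrite ?set11.
    apply/clique_facesP; split; first by apply/set0Pn; exists y; rewrite setU11.
    move=> a b; rewrite !in_setU1 => /orP[/eqP->|aS] /orP[/eqP->|bS] ab.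
    - by rewrite eqxx in ab.
    - by rewrite adj_sym adjy // eq_sym.
    - exact: adjy.
    - exact: sC.
  - move: rY'; congr realizes; apply/setP=> s; rewrite !inE.
    by case: (c \subset s); rewrite ?andbF ?andbT.
have cT' : {in c & T :\ v, forall x z, adj x z}.
  by move=> x z xc /setD1P[_]; apply: cT.
have vc := disj T v cT vT.
have [Z rZ] := exists_realization (F0 (T :\ v)) (Fdown (T :\ v)).
apply: (@simple_trans _ Z); last exact: IH rZ rY'.
apply: (@collapse_open_star X _ (v |: c) w _ _ (F0 T) (@Fdown _)) => //.
- by apply/set0Pn; exists v; rewrite setU11.
- by rewrite in_setU1 negb_or wv (disj T).
- move=> s; rewrite ![_ \in F _]inE subUset sub1set.
  move=> /andP[/clique_facesP[s0 sC] /implyP scT] /andP[vs cs].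
  have {}scT := scT cs; apply/andP; split; last first.
    apply/implyP => _; rewrite subUset scT sub1set andbT.
    by rewrite inE wT orbT.
  have adjw a : a \in s -> a != w -> adj a w.
    move=> aS aw; have := subsetP scT _ aS; rewrite inE => /orP[ac|aT].
      exact: cT.
    rewrite adj_sym; have := subsetP dom a.
    rewrite !inE aT (negbTE aw) /=; apply.
    by case: eqVneq => //= av; apply: sC => //; rewrite eq_sym.
  apply/clique_facesP; split; first by apply/set0Pn; exists w; rewrite setU11.
  move=> a b; rewrite !in_setU1 => /orP[/eqP->|aS] /orP[/eqP->|bS] ab.
  - by rewrite eqxx in ab.
  - by rewrite adj_sym adjw // eq_sym.
  - exact: adjw.
  - exact: sC.
- move: rZ; congr realizes; apply/setP=> s; rewrite ![_ \in F _]inE !inE.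
  rewrite -!andbA; congr (_ && (_ && _)); rewrite subUset sub1set.
  case cs: (c \subset s) => //=; last by rewrite andbF.
  rewrite andbT; apply/idP/andP.
    move=> scT; split; first exact: subset_trans scT (setUS _ (subsetDl _ _)).
    by apply/negP => /(subsetP scT); rewrite !inE eqxx (negbTE vc).
  case=> /subsetP scT vs; apply/subsetP => a aS; have := scT a aS; rewrite !inE.
  by case: (a \in c) => //= ->; rewrite andbT; apply: contraNneq vs => <-.
Qed.

Lemma clique_realizes_full (G : sgraph) (c T : {set G}) :
  (forall z, (forall x, x \in c -> adj x z) -> z \in T) ->
  @realizes (clique_complex G) (clique_complex G)
    [set s in clique_faces G | (c \subset s) ==> (s \subset c :|: T)].
Proof.
move=> cT; have := realizes_faces (clique_complex G).
congr realizes; apply/setP=> s; rewrite !inE /=.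
case sF: (_ && _) => //=; apply/esym/implyP => cs; apply/subsetP => a aS.
have /clique_facesP[_ sC] : s \in clique_faces G by rewrite inE.
rewrite inE; have [//|ac /=] := boolP (a \in c).
apply: cT => x xc; apply: sC => //; first exact: (subsetP cs).
by apply: contraNneq ac => <-.
Qed.

Lemma del_vertex_simple (G : sgraph) (v : G) :
  s_dismantlable v -> simple (clique_complex G) (clique_complex (del_vertex v)).
Proof.
move=> /dismantlable_dsm d; apply: (@collapse_clique_star G [set v] (nbh v)) => //.
- by apply/set0Pn; exists v; rewrite set11.
- by move=> x z /set1P->; rewrite inE.
- by apply: clique_realizes_full => z /(_ v (set11 v)); rewrite inE.
exists val; first exact: val_inj.
apply/setP=> s; rewrite inE sub1set; apply/imsetP/andP.
  case=> t /clique_facesP[t0 tC] ->; split.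
    apply/clique_facesP; split; first by rewrite imset_eq0.
    move=> _ _ /imsetP[a aT ->] /imsetP[b bT ->] ab.
    by apply: (tC a b) => //; rewrite -val_eqE.
  by apply/imsetP => -[x _ vx]; have := valP x; rewrite -vx !inE eqxx.
case=> /clique_facesP[s0 sC] vs.
have sE : s = val @: [set x : del_vertex v | val x \in s].
  apply/setP=> x; apply/idP/imsetP => [xs|[y + ->]]; last by rewrite inE.
  have xv : x \in [set~ v] by rewrite !inE; apply: contraNneq vs => <-.
  by exists (Sub x xv); rewrite ?inE.
exists [set x : del_vertex v | val x \in s] => //.
apply/clique_facesP; split; first by apply: contraNneq s0 => e; rewrite sE e imset0.
by move=> a b; rewrite !inE => aS bS ab; apply: sC.
Qed.

Lemma del_edge_simple (G : sgraph) (v w : G) : adj v w ->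
  dsm (nbh2 v w) -> simple (clique_complex G) (clique_complex (del_edge v w)).
Proof.
move=> vw d; apply: (@collapse_clique_star G [set v; w] (nbh2 v w)) => //.
- by apply/set0Pn; exists v; rewrite set21.
- by move=> x z /set2P[]->; rewrite !inE => /andP[].
- apply: clique_realizes_full => z h.
  by rewrite !inE !h ?set21 ?set22.
have ne : v != w by apply: contraTneq vw => ->; rewrite adj_irr.
have := realizes_faces (clique_complex (del_edge v w)).
case=> f fi e; exists f => //; rewrite {}e; apply/setP=> s; rewrite [RHS]inE.
apply/(@clique_facesP (del_edge v w) s)/andP => [[s0 sC]|[/clique_facesP[s0 sC] vws]].
  split; first by apply/clique_facesP; split=> // a b aS bS /(sC a b aS bS)/andP[].
  apply/negP; rewrite subUset !sub1set => /andP[vs ws].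
  by have /andP[_] := sC v w vs ws ne; rewrite eqxx.
split=> // a b aS bS ab; apply/andP; split; first exact: sC.
by apply: contraNneq vws => <-; rewrite subUset !sub1set aS.
Qed.

Lemma shom_simple (G H : sgraph) :
  shom G H -> simple (clique_complex G) (clique_complex H).
Proof.
have simple_sym X Y : simple X Y -> simple Y X.
  elim=> {X Y} [X Y|X|X Y Z _ h1 _ h2]; last exact: simple_trans h2 h1.
    case=> h; [by apply: rt_step; apply: Or32 | by apply: rt_step; apply: Or31 |].
    exact: realizes_unique (realizes_faces _) h.
  exact: simple_refl.
elim=> {G H} [G H|G|G H K _ h1 _ h2]; last exact: simple_trans h1 h2.
  case=> [[K v d]|[K v d]|[f [g fK gK] fa]]; first exact: del_vertex_simple.
    exact/simple_sym/del_vertex_simple.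
  apply: rt_step; apply: Or33; exists f; first exact: can_inj fK.
  have fcl (s : {set G}) : (f @: s \in clique_faces H) = (s \in clique_faces G).
    apply/clique_facesP/clique_facesP; rewrite imset_eq0 => -[s0 sC]; split=> //.
      move=> a b aS bS ab; rewrite -fa; apply: sC; rewrite ?imset_f //.
      by rewrite (can_eq fK).
    move=> _ _ /imsetP[a aS ->] /imsetP[b bS ->]; rewrite (can_eq fK) fa.
    exact: sC.
  have fgs (s : {set H}) : f @: (g @: s) = s.
    by rewrite -imset_comp -[RHS]imset_id; apply: eq_imset => x /=; rewrite gK.
  apply/setP=> s; apply/imsetP/idP => [[t tG ->]|sH]; first by rewrite fcl.
  by exists (g @: s); rewrite ?fgs // -fcl fgs.
exact: simple_refl.
Qed.

Lemma del_edge_shom (G : sgraph) (v w : G) :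
  adj v w -> dsm (nbh2 v w) -> shom G (del_edge v w).
Proof. by move=> vw d; apply: clique_simple_shom; apply: del_edge_simple. Qed.

(** * Deleting a vertex whose link is s-homotopic to a point *)

Definition K1 : sgraph :=
  @SGraph unit (fun _ _ => false) (fun _ _ => erefl) (fun _ => erefl).

Lemma card1_giso (G : sgraph) : #|G| = 1 -> giso G K1.
Proof.
move=> /eqP; rewrite -cardsT => /cards1P[x Gx].
have all_x (y : G) : y = x by apply/set1P; rewrite -Gx.
exists (fun=> tt).
  by exists (fun=> x) => y; [rewrite [RHS]all_x | case: y].
by move=> y z; rewrite (all_x y) (all_x z) !adj_irr.
Qed.

Lemma dsm_shom_K1 (W : sgraph) (S : {set W}) : dsm S -> shom (induced S) K1.
Proof.
elim=> {S} [x|S v w vS wS wv dom _ IH].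
  by apply/giso_shom/card1_giso; rewrite card_sig cardE enum_set1.
apply: shom_trans IH; apply: shom_delete => //.
apply: (@dsm_cone _ _ w).
  have := subsetP dom v; rewrite !inE eqxx vS => /(_ isT).
  by rewrite wS eq_sym (negbTE wv) adj_sym.
move=> u; rewrite !inE => /andP[uS vu] uw.
by have := subsetP dom u; rewrite !inE uS vu orbT (negbTE uw); apply.
Qed.

Lemma add_vertex_emb (G : sgraph) (S : {set G}) :
  emb G ([set: add_vertex S] :\ None).
Proof.
have -> : [set: add_vertex S] :\ None = Some @: [set: G].
  apply/setP=> -[x|]; rewrite !inE; first by rewrite imset_f ?inE.
  by symmetry; apply/negbTE/imsetP => -[].
by apply: (@emb_imset _ G (add_vertex S)) (emb_setT G) => // ? ? [].
Qed.

Lemma add_cone_shom (G : sgraph) (S : {set G}) (v : G) :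
  v \in S -> {in S, forall x, x != v -> adj v x} -> shom G (add_vertex S).
Proof.
move=> vS cone.
apply: (shom_trans (emb_shom (add_vertex_emb S) (emb_induced _))).
apply: (shom_trans (shom_sym _) (emb_shom (emb_induced _) (emb_setT _))).
apply: shom_delete; rewrite ?inE //.
apply: (@dsm_cone (add_vertex S) _ (Some v)); first by rewrite !inE.
by case=> [x|]; rewrite !inE //= => xS xv; apply: cone.
Qed.

Definition deletable_link (L : sgraph) : Prop :=
  forall (W : sgraph) (v : W), emb L (nbh v) -> shom W (del_vertex v).

(* Dropping u from the link of v is the deletion of the edge {v, u}, whose
   common neighbourhood is dismantlable. *)
Lemma deletable_link_shrink (L : sgraph) (u : L) :
  s_dismantlable u -> deletable_link (del_vertex u) -> deletable_link L.
Proof.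
move=> du IH W v [f [fi fa fS]].
have vf x : adj v (f x) by have := imset_f f (in_setT x); rewrite fS inE.
have vE : v != f u by apply: contraTneq (vf u) => <-; rewrite adj_irr.
apply: (@shom_trans _ (del_edge v (f u))).
  apply: del_edge_shom => //; apply: emb_dsm du _.
  by rewrite /nbh2 -fS; apply: emb_image_nbh.
pose W' := del_edge v (f u); pose v' : W' := v.
have keep (x y : W) : x != v -> y != v -> @adj W' x y = adj x y.
  move=> xv yv; rewrite /= /del_edge_adj; case: adj => //=.
  apply: contraTneq (set21 v (f u)) => <-.
  by rewrite !inE !(eq_sym v) (negbTE xv) (negbTE yv).
apply: (@shom_trans _ (del_vertex v')).
  apply: IH; have [g [gi ga gS]] := emb_image_del_vertex u fi fa.
  have gv x : g x != v.
    have := imset_f g (in_setT x); rewrite gS fS !inE => /andP[_].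
    by apply: contraTneq => ->; rewrite adj_irr.
  exists (g : _ -> W'); split=> //.
    by move=> x y; rewrite keep ?gv // ga.
  rewrite gS fS; apply/setP=> x; rewrite !inE /= /del_edge_adj andbC.
  congr andb; apply/idP/idP; last by apply: contraNneq => ->.
  apply: contraNneq => e; have := set22 v x; rewrite e !inE.
  case/orP=> [/eqP xv|//]; move: (set22 v (f u)).
  by rewrite -e xv !inE orbb eq_sym (negbTE vE).
apply: (@emb_shom _ _ W [set~ v]); last exact: emb_induced.
have [g [gi ga gS]] := @emb_induced W' [set~ v'].
exists (g : _ -> W); split=> // x y; rewrite -ga keep //.
  by have := imset_f g (in_setT x); rewrite gS !inE.
by have := imset_f g (in_setT y); rewrite gS !inE.
Qed.

(* u is added as a new vertex, joined to v and to its neighbours in L; its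
   link is a cone with apex v, and dismantlable once v is deleted. *)
Lemma deletable_link_grow (L : sgraph) (u : L) :
  s_dismantlable u -> deletable_link L -> deletable_link (del_vertex u).
Proof.
move=> du IH W v [f [fi fa fS]].
have vf x : adj v (f x) by have := imset_f f (in_setT x); rewrite fS inE.
have fv x : f x != v by apply: contraTneq (vf x) => ->; rewrite adj_irr.
pose S := v |: f @: [set x | adj u (val x)]; pose W' := add_vertex S.
apply: (@shom_trans _ W').
  apply: (@add_cone_shom _ _ v); first exact: setU11.
  by move=> x; rewrite in_setU1 => /orP[->//|/imsetP[y _ ->]].
pose v' : W' := Some v.
pose h (x : L) : W' := omap f (insub x).
have hu : h u = None by rewrite /h insubF // !inE eqxx.
have hval (x : del_vertex u) : h (val x) = Some (f x) by rewrite /h valK.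
have hP x : x = u \/ exists y : del_vertex u, x = val y.
  have [->|xu] := eqVneq x u; first by left.
  have xu' : x \in [set~ u] by rewrite !inE.
  by right; exists (Sub x xu').
have hS (y : del_vertex u) : (f y \in S) = adj u (val y).
  rewrite in_setU1 (negbTE (fv y)) /=; apply/imsetP/idP => [[z + /fi ->]|uy].
    by rewrite inE.
  by exists y; rewrite ?inE.
have hi : injective h.
  move=> x y; case: (hP x) (hP y) => [->|[{}x ->]] [->|[{}y ->]] //;
    by rewrite ?hu ?hval // => -[/fi->].
have ha x y : adj (h x) (h y) = adj x y.
  case: (hP x) (hP y) => [->|[{}x ->]] [->|[{}y ->]]; rewrite ?hu ?hval /=.
  - by rewrite adj_irr.
  - exact: hS.
  - by rewrite hS adj_sym.
  - exact: fa.
have hT : h @: [set: L] = nbh v'.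
  apply/setP=> -[x|]; rewrite inE /=.
    apply/imsetP/idP => [[y _]|vx].
      by case: (hP y) => [->|[{}y ->]]; rewrite ?hu ?hval // => -[->].
    have /imsetP[y _ ->] : x \in f @: setT by rewrite fS inE.
    by exists (val y); rewrite ?hval.
  by rewrite setU11; apply/imsetP; exists u.
apply: (@shom_trans _ (del_vertex v')); first by apply: IH; exists h.
apply: (@shom_trans _ (induced ([set~ v'] :\ None))).
  apply: shom_delete; first by rewrite !inE.
  apply: emb_dsm du _; have := emb_image_nbh u hi ha; rewrite hT hu.
  congr emb; apply/setP=> -[x|]; rewrite !inE /=; last by rewrite andbF.
  case xS: (x \in S); rewrite ?andbF ?andbT //.
  move: xS; rewrite in_setU1 => /orP[/eqP->|/imsetP[y _ ->]].
    by rewrite adj_irr eqxx.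
  by rewrite vf; symmetry; apply: contra_neq (fv y) => -[].
apply: (@emb_shom _ _ W' _ (emb_induced _)).
have -> : [set~ v'] :\ None = Some @: [set~ v].
  apply/setP=> -[x|]; rewrite !inE.
    by rewrite mem_imset ?inE // => ? ? [].
  by symmetry; apply/negbTE/imsetP => -[].
by apply: (@emb_imset _ W W') (emb_induced _) => // ? ? [].
Qed.

Lemma contractible_deletable (L : sgraph) : shom L K1 -> deletable_link L.
Proof.
have base : deletable_link K1.
  move=> W v [f [_ _ fS]].
  have d : dsm (nbh v).
    have -> : nbh v = [set f tt]; last exact: dsm_set1.
    by rewrite -fS; apply/setP=> x; apply/imsetP/set1P => [[[] _ ->]|->]; last exists tt.
  by apply: rt_step; apply: Or31; apply: SDeletion; apply/dismantlable_dsm.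
suff step G H : shom G H -> deletable_link H -> deletable_link G.
  by move=> h; apply: step h base.
elim=> {G H} [G H|//|G H K _ h1 _ h2 hK]; last exact/h1/h2.
case=> [[{}G v dv]|[{}G v dv]|iso].
- exact: deletable_link_shrink.
- exact: deletable_link_grow.
- by move=> hH W v eG; apply: hH; apply: giso_emb (giso_sym iso) eG.
Qed.

Lemma contractible_delete (W : sgraph) (v : W) :
  shom (induced (nbh v)) K1 -> shom W (del_vertex v).
Proof. by move=> /contractible_deletable; apply; apply: emb_induced. Qed.

Lemma emb_shom_K1 (H W : sgraph) (S : {set W}) :
  emb H S -> shom H K1 -> shom (induced S) K1.
Proof.
by move=> e h; apply: shom_trans h; apply: emb_shom (emb_induced _) e.
Qed.

(* del_edge v w is obtained by adding a twin of v not joined to w, and then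
   deleting v. *)
Lemma contractible_del_edge (G : sgraph) (v w : G) : adj v w ->
  shom (induced (nbh2 v w)) K1 -> shom G (del_edge v w).
Proof.
move=> vw c; have wv : w != v by apply: contraTneq vw => ->; rewrite adj_irr.
pose S := v |: (nbh v :\ w); pose G' := add_vertex S; pose v' : G' := Some v.
apply: (@shom_trans _ G').
  apply: (@add_cone_shom _ _ v); first exact: setU11.
  by move=> x; rewrite !inE => /orP[->//|/andP[_ ->]].
pose w' : G' := Some w.
have w'v' : w' \in nbh v' by rewrite inE.
have wS : w \notin S by rewrite !inE (negbTE wv) eqxx.
have link : shom (induced (nbh v')) K1.
  apply: (@shom_trans _ (induced (nbh v' :\ w'))).
    apply: (@shom_trans _ (@del_vertex (induced (nbh v')) (Sub w' w'v'))).
      apply: contractible_delete.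
      apply: shom_trans c; apply: (emb_shom (emb_nbh _)).
      have -> : nbh v' :&: nbh w' = Some @: nbh2 v w.
        apply/setP=> -[x|]; rewrite !inE /=; first by rewrite mem_imset ?inE // => ? ? [].
        rewrite (negbTE wS) andbF; by symmetry; apply/negbTE/imsetP => -[].
      by apply: (@emb_imset _ G G') (emb_induced _) => // ? ? [].
    exact: emb_shom (emb_del_vertex _) (emb_induced _).
  apply: dsm_shom_K1; apply: (@dsm_cone G' _ None).
    by rewrite in_setD1 inE /= setU11.
  case=> [x|//]; rewrite in_setD1 inE /= => /andP[xw vx] _.
  by rewrite !inE vx andbT orbC; apply/orP; left; apply: contra_neq xw => ->.
apply: (shom_trans (contractible_delete link)).
apply: (emb_shom (emb_induced _)).
exists (fun x => if x == v then None else Some x); split.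
- by move=> x y; have [->|xv] := eqVneq x v; have [->|yv] := eqVneq y v => // -[].
- have edge y : y != v -> (y \in S) = del_edge_adj v w v y.
    move=> yv; rewrite !inE (negbTE yv) /= /del_edge_adj andbC; congr andb.
    apply/idP/idP; last by apply: contraNneq => ->.
    apply: contraNneq => e; have := set22 v y; rewrite e !inE.
    by rewrite (negbTE yv).
  move=> x y; have [->|xv] := eqVneq x v; have [->|yv] := eqVneq y v => //=.
  + by rewrite del_edge_irr.
  + exact: edge.
  + by rewrite edge // del_edge_sym.
  rewrite /del_edge_adj; case: adj => //=; symmetry.
  apply: contraTneq (set21 v w) => <-.
  by rewrite !inE !(eq_sym v) (negbTE xv) (negbTE yv).
- apply/setP=> -[x|]; rewrite !inE; last first.
    by apply/imsetP; exists v; rewrite ?eqxx.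
  apply/imsetP/idP => [[y _]|xv].
    by have [//|yv [->]] := eqVneq y v; apply: contra_neq yv => -[].
  by exists x; rewrite // ifN //; apply: contra_neq xv => ->.
Qed.

(** * I-homotopy *)

Lemma I_contractible_shom (G : sgraph) : I_contractible G -> shom G K1.
Proof.
elim=> {G} [G|G H iso _ h|G v _ h _ hv|G v _ h _ hv|G v w vw _ h _ hvw
           |G v w vw _ h _ hvw].
- by move=> /card1_giso/giso_shom.
- by apply: shom_trans h; apply: giso_shom (giso_sym iso).
- exact: shom_trans (shom_sym (contractible_delete hv)) h.
- exact: shom_trans (contractible_delete hv) h.
- exact: shom_trans (shom_sym (contractible_del_edge vw hvw)) h.
- exact: shom_trans (contractible_del_edge vw hvw) h.
Qed.

Lemma I_transformation_shom (G H : sgraph) : I_transformation G H -> shom G H.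
Proof.
case=> {G H} [G v|G S|G v w vw|G v w vw nvw] /I_contractible_shom c.
- exact: contractible_delete.
- pose p : add_vertex S := None.
  apply: (@shom_trans _ (del_vertex p)); last first.
    apply: shom_sym; apply: contractible_delete.
    apply: emb_shom_K1 c; have -> : nbh p = Some @: S.
      apply/setP=> -[x|]; rewrite !inE /=; first by rewrite mem_imset // => ? ? [].
      by symmetry; apply/negbTE/imsetP => -[].
    by apply: (@emb_imset _ G (add_vertex S)) (emb_induced _) => // ? ? [].
  apply: (emb_shom (add_vertex_emb S)).
  by rewrite setTD; apply: emb_induced.
- exact: contractible_del_edge.
pose H := add_edge v w; pose v' : H := v; pose w' : H := w.
have addE (x y : G) : @adj H x y = adj x y || (x != y) && ([set x; y] == [set v; w]).
  by [].
have v'w' : adj v' w' by rewrite addE vw eqxx orbT.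
apply: (@shom_trans _ (del_edge v' w')).
  apply: giso_shom; exists id; first by exists id.
  move=> x y; rewrite /= /del_edge_adj addE.
  have [e|_] := eqVneq [set x; y] [set v; w]; last by rewrite andbF orbF andbT.
  rewrite andbF; symmetry; apply: contraNF nvw => xy.
  have vxy : v \in [set x; y] by rewrite e set21.
  have wxy : w \in [set x; y] by rewrite e set22.
  case/set2P: vxy vw => ->; case/set2P: wxy => ->; rewrite ?eqxx //.
  by rewrite adj_sym.
apply: shom_sym; apply: contractible_del_edge => //.
have old (x y : G) : x != v -> x != w -> (@adj H x y = adj x y) /\ (@adj H y x = adj y x).
  move=> xv xw; have ne : ([set x; y] == [set v; w]) = false.
    by apply: contraTF (set21 x y) => /eqP->; rewrite !inE negb_or xv.
  by rewrite !addE [[set y; x]]setUC ne !andbF !orbF.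
have inN x : x \in nbh2 v w -> x != v /\ x != w.
  by rewrite !inE => /andP[vx wx]; split;
    [apply: contraTneq vx | apply: contraTneq wx] => ->; rewrite adj_irr.
apply: emb_shom_K1 c.
have [g [gi ga gS]] := emb_induced (nbh2 v w).
have gN x : g x \in nbh2 v w by rewrite -gS imset_f.
exists (g : _ -> H); split=> //.
  by move=> x y; have [gv gw] := inN _ (gN x); rewrite (old _ _ gv gw).1 ga.
rewrite gS; apply/setP=> x; apply/idP/idP => [xN|].
  have [xv xw] := inN x xN; move: xN; rewrite !inE.
  by rewrite (old x v xv xw).2 (old x w xv xw).2.
rewrite [x \in @nbh2 H _ _]inE => /andP[]; rewrite ![_ \in @nbh H _]inE => vx wx.
have xv : x != v by apply: contraTneq vx => ->; rewrite adj_irr.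
have xw : x != w by apply: contraTneq wx => ->; rewrite adj_irr.
move: vx wx; rewrite (old x v xv xw).2 (old x w xv xw).2 => vx wx.
by rewrite !inE vx.
Qed.

Lemma I_contractible_add (W : sgraph) (S : {set W}) (v : W) : v \in S ->
  I_contractible (induced (S :\ v)) -> I_contractible (induced (S :&: nbh v)) ->
  I_contractible (induced S).
Proof.
move=> vS h hv; apply: (@I_add_vertex (induced S) (Sub v vS)).
  by apply: I_giso h; apply: emb_giso (emb_induced _) (emb_del_vertex _).
by apply: I_giso hv; apply: emb_giso (emb_induced _) (emb_nbh _).
Qed.

Lemma I_contractible_cone (W : sgraph) (S : {set W}) (w : W) :
  w \in S -> {in S, forall u, u != w -> adj w u} -> I_contractible (induced S).
Proof.
have [n] := ubnP #|S|; elim: n S => // n IH S leSn wS cone.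
have [S1|[v]] := set_0Vmem (S :\ w).
  apply: I_K1; rewrite card_sig.
  have -> : #|[pred x in S]| = #|S| by apply: eq_card.
  by rewrite (cardsD1 w) wS S1 cards0.
rewrite !inE => /andP[vw vS]; apply: (I_contractible_add vS).
  apply: IH; first by rewrite (cardsD1 v) vS in leSn.
    by rewrite !inE eq_sym vw.
  by move=> u /setD1P[_]; apply: cone.
apply: IH.
- have: #|S :&: nbh v| < #|S|; last by move=> h; apply: leq_trans h _.
  apply: proper_card; apply/properP; split; first exact: subsetIl.
  by exists v; rewrite // !inE adj_irr andbF.
- by rewrite !inE wS adj_sym cone.
- by move=> u /setIP[uS _]; apply: cone.
Qed.

Lemma dsm_I_contractible (W : sgraph) (S : {set W}) :
  dsm S -> I_contractible (induced S).
Proof.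
elim=> {S} [x|S v w vS wS wv dom _ IH].
  by apply: (@I_contractible_cone _ _ x); rewrite ?set11 // => u /set1P->; rewrite eqxx.
apply: (I_contractible_add vS IH); apply: (@I_contractible_cone _ _ w).
  have := subsetP dom v; rewrite !inE eqxx vS => /(_ isT).
  by rewrite wS eq_sym (negbTE wv) adj_sym.
move=> u; rewrite !inE => /andP[uS vu] uw.
by have := subsetP dom u; rewrite !inE uS vu orbT (negbTE uw); apply.
Qed.

Lemma shom_I_homotopy (G H : sgraph) : shom G H -> I_homotopy_equiv G H.
Proof.
elim=> {G H} [G H|G|G H K _ h1 _ h2]; last 2 first.
- exact: rt_refl.
- exact: rt_trans h1 h2.
case=> [[K v d]|[K v d]|iso]; last by apply: rt_step; right.
  by apply: rt_step; left; apply: I1; apply/dsm_I_contractible/dismantlable_dsm.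
pose S : {set del_vertex v} := [set x | adj v (val x)].
have vS : val @: S = nbh v.
  apply/setP=> x; rewrite inE; apply/imsetP/idP => [[y + ->]|vx].
    by rewrite inE.
  have xv : x \in [set~ v] by rewrite !inE; apply: contraTneq vx => ->; rewrite adj_irr.
  by exists (Sub x xv); rewrite ?inE.
apply: (@rt_trans _ _ _ (add_vertex S)); apply: rt_step; [left|right].
  apply: I2; apply/dsm_I_contractible; apply: emb_dsm d _.
  have [g [gi ga gS]] : emb (induced S) (nbh v).
    by rewrite -vS; apply: emb_imset (emb_induced _); first exact: val_inj.
  apply: giso_emb (emb_induced S).
  apply: emb_giso (emb_induced _) _; by exists g.
apply: (@emb_giso _ _ K [set: K]); last exact: emb_setT.
exists (fun x => if x is Some y then val y else v); split.
- have nv (y : del_vertex v) : val y <> v.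
    by move=> e; have := valP y; rewrite e !inE eqxx.
  by move=> [x|] [y|] // => [/val_inj->|/nv|/esym/nv].
- by move=> [x|] [y|] //=; rewrite ?inE ?adj_irr // adj_sym.
- apply/setP=> x; rewrite inE; apply/imsetP.
  have [->|xv] := eqVneq x v; first by exists None.
  have xv' : x \in [set~ v] by rewrite !inE.
  by exists (Some (Sub x xv')).
Qed.

Lemma I_homotopy_shom (G H : sgraph) : I_homotopy_equiv G H -> shom G H.
Proof.
elim=> {G H} [G H []|G|G H K _ h1 _ h2].
- exact: I_transformation_shom.
- exact: giso_shom.
- exact: shom_refl.
- exact: shom_trans h1 h2.
Qed.

Theorem theorem1p2 (G H : sgraph) :
  (I_homotopy_equiv G H <-> s_homotopy_equiv G H) /\
  (s_homotopy_equiv G H <->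
   simple_homotopy_equiv (clique_complex G) (clique_complex H)).
Proof.
split; split.
- exact: I_homotopy_shom.
- exact: shom_I_homotopy.
- exact: shom_simple.
- exact: clique_simple_shom.
Qed.
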